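(* Let $S=\mathbb{K}[x_1,\dots,x_n]$ be a polynomial ring over a field $\mathbb{K}$. Every variable decomposable monomial ideal $I\subset S$ has linear quotients.
   Context: $G(I)$ denotes the set of minimal monomial generators of a monomial ideal $I$, and $\mathfrak{m}=\langle x_1,\dots,x_n\rangle$. $I$ has linear quotients if there is an order $u_1,\dots,u_m$ of $G(I)$ such that for each $i=2,\dots,m$ the colon ideal $\langle u_1,\dots,u_{i-1}\rangle:u_i$ is generated by a subset of the variables (principal monomial ideals, including $\langle 0\rangle$ and $\langle 1\rangle$, trivially have linear quotients). Variable decomposable monomial ideals are defined recursively on the number of variables: a monomial ideal $I\subset S=\mathbb{K}[x_1,\dots,x_n]$ is variable decomposable if either (a) $I=\langle 0\rangle$ or $I=\langle 1\rangle$, or (b) there is a variable $x_v$ (called a shedding variable) such that, with $r=\max\{\deg_{x_v}(u):u\in G(I)\}$, all the ideals $$I_i:=\langle u/x_v^i: u\in G(I)\text{ and }\deg_{x_v}(u)=i\rangle\subset\mathbb{K}[x_1,\dots,\widehat{x_v},\dots,x_n],\qquad i=0,1,\dots,r,$$ are variable decomposable, and $I_{i-1}\subset I_i\mathfrak{m}$ for each $i=1,2,\dots,r$ (here the $I_i$ are extended to ideals of $S$). *)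

(* Defs.v *)
From mathcomp Require Import all_boot all_order all_algebra.
From mathcomp Require Import mpoly.
From Stdlib Require Import Classical.

Set Implicit Arguments.
Unset Strict Implicit.
Unset Printing Implicit Defensive.

Import GRing.Theory.
Local Open Scope ring_scope.

(* Ideals are Prop-valued sets compared extensionally: ring_quotient's
   [idealr_closed] is boolean and excludes the unit ideal. *)

Definition same_set (T : Type) (A B : T -> Prop) : Prop :=
  forall x, A x <-> B x.

Section CommutativeRing.

Variable R : comNzRingType.

Definition ideal_gen (A : R -> Prop) : R -> Prop := fun f =>
  exists (k : nat) (c g : 'I_k -> R),
    (forall i, A (g i)) /\ f = \sum_(i < k) c i * g i.

Definition ideal_mul (I J : R -> Prop) : R -> Prop :=
  ideal_gen (fun h => exists f g, [/\ I f, J g & h = f * g]).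

Definition ideal_colon (I : R -> Prop) (u : R) : R -> Prop :=
  fun f => I (f * u).

End CommutativeRing.

Section MonomialIdeals.

Variables (K : fieldType) (n : nat).

Implicit Types (I : {mpoly K[n]} -> Prop) (A : 'X_{1..n} -> Prop).

Definition monomial_gen A : {mpoly K[n]} -> Prop :=
  ideal_gen (fun f => exists2 u, A u & f = 'X_[u]).

Definition monomial_ideal I : Prop :=
  exists A, same_set I (monomial_gen A).

(* The set G(I): the monomials of I that are minimal for divisibility.  For a
   monomial ideal it is the least set of monomials generating I, see
   [min_gens_generate] and [min_gens_least] below. *)
Definition min_gens I : 'X_{1..n} -> Prop := fun u =>
  I 'X_[u] /\ forall w : 'X_{1..n}, I 'X_[w] -> (w <= u)%MM -> w = u.

Definition variables_gen (V : {set 'I_n}) : {mpoly K[n]} -> Prop :=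
  ideal_gen (fun f => exists2 j, j \in V & f = 'X_j).

Definition max_ideal : {mpoly K[n]} -> Prop := variables_gen [set: 'I_n].

Definition linear_quotients I : Prop :=
  exists s : seq 'X_{1..n},
    [/\ uniq s,
        forall u, u \in s <-> min_gens I u
      & forall i : nat, (0 < i < size s)%N ->
          exists V : {set 'I_n},
            same_set
              (ideal_colon (monomial_gen (fun u => u \in take i s))
                           'X_[nth 0%MM s i])
              (variables_gen V)].

Definition trivial_ideal I : Prop :=
  same_set I (fun f => f = 0) \/ same_set I (fun _ => True).

End MonomialIdeals.

Arguments monomial_gen K {n} A _.
Arguments max_ideal K n _ : clear implicits.

Section Shedding.

Variables (K : fieldType) (n : nat) (v : 'I_n.+1).

(* The n variables other than x_v are indexed by 'I_n through [lift v]. *)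

(* For deg_{x_v}(u) = i this is u / x_v^i, in the other variables. *)
Definition drop_var (u : 'X_{1..n.+1}) : 'X_{1..n} :=
  [multinom u (lift v j) | j < n].

Definition shed_ideal (I : {mpoly K[n.+1]} -> Prop) (i : nat) :
    {mpoly K[n]} -> Prop :=
  monomial_gen K (fun w =>
    exists u, [/\ min_gens I u, u v = i & w = drop_var u]).

Definition add_var (p : {mpoly K[n]}) : {mpoly K[n.+1]} :=
  p \mPo [tuple ('X_(lift v j) : {mpoly K[n.+1]}) | j < n].

Definition extend_ideal (J : {mpoly K[n]} -> Prop) : {mpoly K[n.+1]} -> Prop :=
  ideal_gen (fun f => exists2 p, J p & f = add_var p).

Definition max_degree (I : {mpoly K[n.+1]} -> Prop) (r : nat) : Prop :=
  (exists2 u, min_gens I u & u v = r) /\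
  (forall u, min_gens I u -> (u v <= r)%N).

End Shedding.

Fixpoint variable_decomposable (K : fieldType) (n : nat) :
    ({mpoly K[n]} -> Prop) -> Prop :=
  match n return ({mpoly K[n]} -> Prop) -> Prop with
  | 0 => fun I => trivial_ideal I
  | n'.+1 => fun I =>
      trivial_ideal I \/
      exists (v : 'I_n'.+1) (r : nat),
        [/\ max_degree v I r,
            forall i : nat, (i <= r)%N ->
              variable_decomposable (shed_ideal v I i)
          & forall i : nat, (1 <= i <= r)%N ->
              forall f : {mpoly K[n'.+1]},
                extend_ideal v (shed_ideal v I i.-1) f ->
                ideal_mul (extend_ideal v (shed_ideal v I i))
                          (max_ideal K n'.+1) f]
  end.

Section MinGens.

Variables (K : fieldType) (n : nat).

Lemma monomial_gen_supp (A : 'X_{1..n} -> Prop) (f : {mpoly K[n]}) m :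
  monomial_gen K A f -> m \in msupp f -> exists2 u, A u & (u <= m)%MM.
Proof.
move=> [k [c [g [gA ->]]]] /msupp_sum_le /flattenP [s /mapP [i _ ->]].
have [u Au ->] := gA i; rewrite (perm_mem (msuppMX _ _)) => /mapP [w _ ->].
by exists u => //; apply: lem_addr.
Qed.

Lemma monomial_genX (A : 'X_{1..n} -> Prop) (m : 'X_{1..n}) :
  monomial_gen K A 'X_[m] <-> exists2 u, A u & (u <= m)%MM.
Proof.
split=> [/monomial_gen_supp|[u Au le_um]]; first by apply; rewrite msuppX inE.
exists 1%N, (fun=> 'X_[m - u]), (fun=> 'X_[u]); split; first by move=> _; exists u.
by rewrite big_ord1 -mpolyXD submK.
Qed.

Lemma min_gens_below (I : {mpoly K[n]} -> Prop) (m : 'X_{1..n}) :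
  I 'X_[m] -> exists2 u, min_gens I u & (u <= m)%MM.
Proof.
have [d] := ubnP (mdeg m); elim: d m => // d IHd m lt_md Im.
have [mG|notG] := classic (min_gens I m); first by exists m => //; apply: lepm_refl.
have [w [Iw le_wm ne_wm]] : exists w, [/\ I 'X_[w], (w <= m)%MM & w <> m].
  apply: NNPP => noW; apply: notG; split=> // w Iw le_wm.
  by apply: NNPP => ne_wm; apply: noW; exists w.
have lt_wm : (mdeg w < mdeg m)%N.
  rewrite -(submK le_wm) mdegD -[ltnLHS]add0n ltn_add2r lt0n mdeg_eq0.
  apply/eqP => m_w0; apply: ne_wm.
  by rewrite -(submK le_wm) m_w0 add0m.
have [|u uG le_uw] := IHd w _ Iw; first exact: leq_trans lt_wm _.
by exists u => //; apply: lepm_trans le_uw le_wm.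
Qed.

Lemma min_gens_least (I : {mpoly K[n]} -> Prop) (A : 'X_{1..n} -> Prop) u :
  same_set I (monomial_gen K A) -> min_gens I u -> A u.
Proof.
move=> IA [/IA /monomial_genX [w Aw le_wu] uP]; rewrite -(uP w) //.
by apply/IA/monomial_genX; exists w => //; apply: lepm_refl.
Qed.

Lemma min_gens_generate (I : {mpoly K[n]} -> Prop) :
  monomial_ideal I -> same_set I (monomial_gen K (min_gens I)).
Proof.
move=> [A IA] f; split=> [/IA|] [k [c [g [gP ->]]]]; last first.
  apply/IA; exists k; suff /fin_all_exists2 [h hA hE] : forall i,
    exists2 w : {mpoly K[n]} * 'X_{1..n}, A w.2 & g i = w.1 * 'X_[w.2].
    exists (fun i => c i * (h i).1), (fun i => 'X_[(h i).2]); split.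
      by move=> i; exists (h i).2.
    by apply: eq_bigr => i _; rewrite hE mulrA.
  move=> i; have [u [/IA /monomial_genX [w Aw le_wu] _] ->] := gP i.
  by exists ('X_[u - w], w) => //=; rewrite -mpolyXD submK.
exists k; suff /fin_all_exists2 [h hA hE] : forall i,
  exists2 w : {mpoly K[n]} * 'X_{1..n}, min_gens I w.2 & g i = w.1 * 'X_[w.2].
  exists (fun i => c i * (h i).1), (fun i => 'X_[(h i).2]); split.
    by move=> i; exists (h i).2.
  by apply: eq_bigr => i _; rewrite hE mulrA.
move=> i; have [u Au ->] := gP i.
have /min_gens_below [w wG le_wu] : I 'X_[u].
  by apply/IA/monomial_genX; exists u => //; apply: lepm_refl.
by exists ('X_[u - w], w) => //=; rewrite -mpolyXD submK.
Qed.

End MinGens.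

(* Main.v *)
Require Import Defs.
From mathcomp Require Import all_boot all_order all_algebra.
From mathcomp Require Import mpoly.

(** Every level [I_i] of a shedding variable [x_v] has, by induction on the
number of variables, an order of its generators with linear quotients.
Multiplying the [i]-th list by [x_v ^ i] and listing the levels by decreasing
degree in [x_v], from [r] down to [0], gives the order for [I].  Indeed let [u]
be a generator of degree [i].  An earlier generator of larger degree contributes
to the colon ideal at [u] only monomials divisible by [x_v]; and [x_v] itself
lies in that colon ideal as soon as [i < r], since the inclusion of [I_i] in
[I_(i+1)] m provides a generator of degree [i + 1] dividing [x_v * u].  The
earlier generators of the same degree contribute what they contribute in [I_i],
which is generated by variables.

The induction is carried by a purely combinatorial form of linear quotients
([linear_order]): each earlier [w] has an [x_j]-degree larger than that of [u]
for some variable [x_j] such that an earlier generator divides [x_j * u].  The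
step is [linear_order_cat_level]; [linear_order_quotients] returns to ideals. *)

Set Implicit Arguments.
Unset Strict Implicit.
Unset Printing Implicit Defensive.

Import GRing.Theory.
Local Open Scope ring_scope.

(** * Ideals generated by a set *)

Section IdealGen.

Variable R : comNzRingType.
Implicit Types A B : R -> Prop.

Lemma ideal_gen_id A a : A a -> ideal_gen A a.
Proof.
move=> Aa; exists 1%N, (fun=> 1), (fun=> a); split=> //.
by rewrite big_ord1 mul1r.
Qed.

Lemma ideal_gen0 A : ideal_gen A 0.
Proof.
by exists 0%N, (fun=> 0), (fun=> 0); split=> [[]|] //; rewrite big_ord0.
Qed.

Lemma ideal_genMl A c a : ideal_gen A a -> ideal_gen A (c * a).
Proof.
move=> [k [d [g [Ag ->]]]]; exists k, (fun i => c * d i), g; split=> //.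
by rewrite mulr_sumr; apply: eq_bigr => i _; rewrite mulrA.
Qed.

Lemma ideal_genD A a b : ideal_gen A a -> ideal_gen A b -> ideal_gen A (a + b).
Proof.
move=> [k [c [g [Ag ->]]]] [l [d [h [Ah ->]]]].
exists (k + l)%N, (fun i => match split i with inl j => c j | inr j => d j end).
exists (fun i => match split i with inl j => g j | inr j => h j end); split.
  by move=> i; case: (split i).
rewrite big_split_ord /=; congr (_ + _); apply: eq_bigr => i _.
  by rewrite (unsplitK (inl i)).
by rewrite (unsplitK (inr i)).
Qed.

Lemma ideal_gen_sum A (T : eqType) (s : seq T) (F : T -> R) :
  (forall x, x \in s -> ideal_gen A (F x)) -> ideal_gen A (\sum_(x <- s) F x).
Proof.
move=> AF; rewrite big_seq; elim/big_ind: _ => //; first exact: ideal_gen0.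
by move=> a b; apply: ideal_genD.
Qed.

Lemma ideal_gen_min A B a :
  (forall b, A b -> ideal_gen B b) -> ideal_gen A a -> ideal_gen B a.
Proof.
move=> AB [k [c [g [Ag ->]]]]; apply: ideal_gen_sum => i _.
exact/ideal_genMl/AB.
Qed.

End IdealGen.

(** * Linear quotients in terms of monomials *)

Section LinearOrder.

Variable n : nat.
Implicit Types (s p : seq 'X_{1..n}) (u w : 'X_{1..n}).

(** The colon ideal of the monomials of [p] by [u] is generated by variables:
it is generated by the monomials [w : u] with [w] in [p], and the condition is
that each of these is a multiple of a variable of the colon ideal. *)
Definition variable_colon p u : Prop :=
  forall w, w \in p ->
    exists2 j, (u j < w j)%N & exists2 l, l \in p & (l <= U_(j) + u)%MM.

Definition linear_order s : Prop :=
  forall i, (i < size s)%N -> variable_colon (take i s) (nth 0%MM s i).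

Lemma linear_order_cat s t :
    linear_order s ->
    (forall i, (i < size t)%N ->
       variable_colon (s ++ take i t) (nth 0%MM t i)) ->
  linear_order (s ++ t).
Proof.
move=> s_lin t_lin i; rewrite size_cat take_cat nth_cat => lt_i.
case: ltnP => [|le_si]; first exact: s_lin.
by apply: t_lin; rewrite ltn_subLR.
Qed.

Variable K : fieldType.

(** The colon ideal is monomial, so it suffices to follow the monomials of its
elements; [V] is taken to be the set of all variables that it contains. *)
Lemma variable_colon_gen p u :
    variable_colon p u ->
  exists V : {set 'I_n},
    same_set (ideal_colon (monomial_gen K (fun w => w \in p)) 'X_[u])
             (variables_gen V).
Proof.
move=> pu; pose V := [set j | has (fun l => l <= U_(j) + u)%MM p].
exists V => f; split=> [fu|]; last first.
  move=> [k [c [g [Vg ->]]]]; rewrite /ideal_colon mulr_suml.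
  apply: ideal_gen_sum => i _; have [j + ->] := Vg i.
  rewrite inE => /hasP [l pl le_l]; rewrite -mulrA.
  by apply/ideal_genMl; rewrite -mpolyXD; apply/monomial_genX; exists l.
rewrite [f]mpolyE; apply: ideal_gen_sum => m fm.
have [|w pw le_w] := monomial_gen_supp (m := (u + m)%MM) fu.
  by rewrite (perm_mem (msuppMX _ _)) map_f.
have [j lt_j [l pl le_l]] := pu w pw.
have mj : (U_(j) <= m)%MM.
  rewrite lep1mP -lt0n.
  have := leq_trans lt_j (mnm_lepP le_w j).
  by rewrite mnmDE -[X in (X < _)%N]addn0 ltn_add2l.
rewrite -(submK mj) mpolyXD -mul_mpolyC mulrA.
apply/ideal_genMl/ideal_gen_id; exists j => //.
by rewrite inE; apply/hasP; exists l.
Qed.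

Lemma linear_order_quotients (I : {mpoly K[n]} -> Prop) s :
    uniq s -> (forall u, u \in s <-> min_gens I u) -> linear_order s ->
  linear_quotients I.
Proof.
move=> s_uniq s_gens s_lin; exists s; split=> // i /andP [_ lt_i].
exact/variable_colon_gen/s_lin.
Qed.

Lemma trivial_linear_order (I : {mpoly K[n]} -> Prop) :
    trivial_ideal I ->
  exists s, [/\ uniq s, forall u, u \in s <-> min_gens I u & linear_order s].
Proof.
case=> I_E; [exists [::] | exists [:: 0%MM]]; split=> //.
- move=> u; split=> // -[/I_E /(congr1 (fun f => u \in msupp f))].
  by rewrite msuppX msupp0 !inE eqxx.
- move=> u; rewrite inE; split=> [/eqP ->|[_ u_min]].
    split=> [|w _ /mnm_lepP le_w0]; first exact/I_E.
    by apply/mnmP => i; apply/eqP; have := le_w0 i; rewrite mnm0E leqn0.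
  by rewrite (u_min 0%MM) //; [exact/I_E | apply/mnm_lepP => i; rewrite mnm0E].
- by case.
Qed.

End LinearOrder.

(** * Levels of a shedding variable *)

Section Shedding.

Variables (K : fieldType) (n : nat) (v : 'I_n.+1).
Implicit Types (I : {mpoly K[n.+1]} -> Prop) (w : 'X_{1..n}).

Definition put_var (i : nat) w : 'X_{1..n.+1} :=
  [multinom if unlift v j is Some k then w k else i | j < n.+1].

Lemma put_varE i w : put_var i w v = i.
Proof. by rewrite mnmE unlift_none. Qed.

Lemma put_var_lift i w j : put_var i w (lift v j) = w j.
Proof. by rewrite mnmE liftK. Qed.

Lemma drop_varK (u : 'X_{1..n.+1}) : put_var (u v) (drop_var v u) = u.
Proof.
apply/mnmP => j; rewrite mnmE.
by case: unliftP => [k ->|-> //]; rewrite mnmE.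
Qed.

Lemma put_varK i : cancel (put_var i) (drop_var v).
Proof. by move=> w; apply/mnmP => j; rewrite mnmE put_var_lift. Qed.

Lemma le_drop_var (x y : 'X_{1..n.+1}) :
  (x v <= y v)%N -> (drop_var v x <= drop_var v y)%MM -> (x <= y)%MM.
Proof.
move=> le_v /mnm_lepP le_xy; apply/mnm_lepP => j.
by case: (unliftP v j) => [k ->|-> //]; have := le_xy k; rewrite !mnmE.
Qed.

(** The generators of degree [i] stay pairwise incomparable when [x_v] is
dropped, so each of them remains a minimal generator of the level. *)
Lemma min_gens_shed_ideal I i w :
  min_gens (shed_ideal v I i) w <-> min_gens I (put_var i w).
Proof.
split=> [/(min_gens_least (fun=> iff_refl _)) [u [uI <- ->]]|wI].
  by rewrite drop_varK.
split=> [|w'].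
  apply/monomial_genX; exists w; last exact: lepm_refl.
  by exists (put_var i w); rewrite put_varE put_varK.
move=> /monomial_genX [_ [u [uI u_v ->]] le_uw'] le_w'w.
have u_w : u = put_var i w.
  apply: wI.2 uI.1 _; apply: le_drop_var; first by rewrite put_varE u_v.
  by rewrite put_varK; apply: lepm_trans le_w'w.
move: le_uw'; rewrite u_w put_varK => /mnm_lepP le_ww'.
by apply/mnmP => j; apply/eqP; rewrite eqn_leq le_ww' (mnm_lepP le_w'w).
Qed.

Lemma add_varX w : add_var v ('X_[w] : {mpoly K[n]}) = 'X_[put_var 0 w].
Proof.
rewrite /add_var comp_mpolyX mpolyXE_id (bigD1_ord v) //= put_varE expr0 mul1r.
by apply: eq_bigr => j _; rewrite tnth_mktuple put_var_lift.
Qed.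

Lemma extend_monomial_gen (A : 'X_{1..n} -> Prop) (f : {mpoly K[n.+1]}) :
  extend_ideal v (monomial_gen K A) f ->
  monomial_gen K (fun u => exists2 w, A w & u = put_var 0 w) f.
Proof.
apply: ideal_gen_min => _ [p [k [c [g [Ag ->]]]] ->].
rewrite /add_var rmorph_sum; apply: ideal_gen_sum => i _.
rewrite rmorphM; apply/ideal_genMl/ideal_gen_id.
have [w Aw ->] := Ag i; exists (put_var 0 w); first by exists w.
exact: add_varX.
Qed.

(** The generator [w] of level [i], seen in all the variables, lies in the
extension of level [i + 1]; as that ideal is monomial, one of its generators
divides [w]. *)
Lemma shedding_divisor I i w :
    (forall f : {mpoly K[n.+1]}, extend_ideal v (shed_ideal v I i) f ->
       ideal_mul (extend_ideal v (shed_ideal v I i.+1)) (max_ideal K n.+1) f) ->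
    min_gens I (put_var i w) ->
  exists u, [/\ min_gens I u, u v = i.+1 & (drop_var v u <= w)%MM].
Proof.
move=> shedding wI.
have /shedding w_mul :
    extend_ideal v (shed_ideal v I i) (add_var v 'X_[w]).
  apply: ideal_gen_id; exists 'X_[w] => //.
  by have [] := (min_gens_shed_ideal I i w).2 wI.
have : extend_ideal v (shed_ideal v I i.+1) (add_var v 'X_[w]).
  apply: ideal_gen_min w_mul => _ [f [g [If _ ->]]].
  by rewrite mulrC; apply: ideal_genMl.
rewrite add_varX => /extend_monomial_gen /monomial_genX.
case=> _ [_ [u [uI u_v ->]] ->] /mnm_lepP le_u; exists u; split=> //.
by apply/mnm_lepP => j; have := le_u (lift v j); rewrite !put_var_lift.
Qed.

(** Appending level [i] to the levels above it: the colon ideal at a generator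
of level [i] is that of the level, together with [x_v] if [t] is nonempty. *)
Lemma linear_order_cat_level i (t : seq 'X_{1..n.+1}) (s : seq 'X_{1..n}) :
    linear_order t -> linear_order s ->
    (forall x, x \in t -> (i < x v)%N) ->
    (forall x w, x \in t -> w \in s ->
       exists u, [/\ u \in t, u v = i.+1 & (drop_var v u <= w)%MM]) ->
  linear_order (t ++ map (put_var i) s).
Proof.
move=> t_lin s_lin t_above t_div; apply: linear_order_cat => // k.
rewrite size_map => lt_k x; rewrite (nth_map 0%MM) // -map_take.
set w := nth _ s k; rewrite mem_cat => /orP [tx|/mapP [y sy ->]].
  exists v; first by rewrite put_varE t_above.
  have [u [tu u_v le_uw]] := t_div x w tx (mem_nth _ lt_k).
  exists u; first by rewrite mem_cat tu.
  apply: le_drop_var; first by rewrite mnmDE mnm1E eqxx put_varE u_v add1n.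
  apply: lepm_trans le_uw _; apply/mnm_lepP => j.
  by rewrite mnmE mnmDE put_var_lift leq_addl.
have [j lt_j [l sl le_l]] := s_lin k lt_k y sy.
exists (lift v j); first by rewrite !put_var_lift.
exists (put_var i l); first by rewrite mem_cat map_f ?orbT.
apply: le_drop_var; first by rewrite mnmDE !put_varE leq_addl.
rewrite put_varK; apply: lepm_trans le_l _; apply/mnm_lepP => a.
by rewrite [leqRHS]mnmE !mnmDE put_var_lift !mnm1E (inj_eq lift_inj).
Qed.

(** The list grows from degree [r] downwards, because it is a generator of
degree [i + 1] that puts [x_v] in the colon ideals of level [i].  Minimal
generators of [I] have degree at most [r], so [d = 0] is the empty list and
[d = r.+1] lists them all. *)
Lemma upper_levels_linear_order I r d :
    max_degree v I r ->
    (forall i, (i <= r)%N -> exists s : seq 'X_{1..n},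
       [/\ uniq s, forall w, w \in s <-> min_gens (shed_ideal v I i) w
         & linear_order s]) ->
    (forall i, (1 <= i <= r)%N ->
       forall f : {mpoly K[n.+1]}, extend_ideal v (shed_ideal v I i.-1) f ->
       ideal_mul (extend_ideal v (shed_ideal v I i)) (max_ideal K n.+1) f) ->
    (d <= r.+1)%N ->
  exists t : seq 'X_{1..n.+1},
    [/\ uniq t,
        forall u, u \in t <-> min_gens I u /\ (r.+1 - d <= u v)%N
      & linear_order t].
Proof.
move=> [_ max_r] levels shedding; elim: d => [|d IHd] lt_d.
  exists [::]; split=> // u; split=> // -[/max_r le_ur].
  by rewrite subn0 ltnNge le_ur.
have [t [t_uniq tP t_lin]] := IHd (ltnW lt_d).
pose i := (r - d)%N; have i1E : (r.+1 - d = i.+1)%N by rewrite subSn.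
have [s [s_uniq sP s_lin]] := levels i (leq_subr d r).
exists (t ++ map (put_var i) s); rewrite subSS -/i; split.
- rewrite cat_uniq t_uniq (map_inj_uniq (can_inj (put_varK i))) s_uniq andbT /=.
  apply/hasPn => _ /mapP [w _ ->]; apply/negP => /tP [_].
  by rewrite i1E put_varE ltnn.
- move=> u; rewrite mem_cat; split=> [/orP [/tP [uI]|/mapP [w /sP wI ->]]|].
  + by rewrite i1E => /ltnW.
  + by rewrite put_varE; split=> //; apply/min_gens_shed_ideal.
  + move=> [uI]; rewrite leq_eqVlt -i1E => /orP [/eqP u_v|lt_iu]; last first.
      by apply/orP; left; apply/tP.
    apply/orP; right; apply/mapP; exists (drop_var v u).
      by apply/sP/min_gens_shed_ideal; rewrite u_v drop_varK.
    by rewrite u_v drop_varK.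
apply: linear_order_cat_level => // [x /tP []|x w /tP [xI lt_ix] /sP wI].
  by rewrite i1E.
have lt_ir : (i < r)%N by rewrite -i1E (leq_trans lt_ix) ?max_r.
have [||u [uI u_v le_uw]] := shedding_divisor (I := I) (i := i) (w := w).
- exact: (shedding i.+1).
- exact/min_gens_shed_ideal.
- by exists u; split=> //; apply/tP; rewrite i1E u_v.
Qed.

End Shedding.

(** * Variable decomposable ideals *)

Lemma variable_decomposable_linear_order (K : fieldType) (n : nat)
    (I : {mpoly K[n]} -> Prop) :
    variable_decomposable I ->
  exists s, [/\ uniq s, forall u, u \in s <-> min_gens I u & linear_order s].
Proof.
elim: n I => [|n IHn] I /=; first exact: trivial_linear_order.
case=> [|[v [r [max_r levels shedding]]]]; first exact: trivial_linear_order.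
have [|t [t_uniq tP t_lin]] :=
    upper_levels_linear_order max_r _ shedding (leqnn r.+1).
  by move=> i le_ir; apply: IHn; apply: levels.
exists t; split=> // u; split=> [/tP []|uI] //.
by apply/tP; rewrite subnn.
Qed.

Theorem proposition4p32 (K : fieldType) (n : nat) (I : {mpoly K[n]} -> Prop) :
  monomial_ideal I -> variable_decomposable I -> linear_quotients I.
Proof.
move=> _ /variable_decomposable_linear_order [s [s_uniq s_gens s_lin]].
exact: linear_order_quotients s_uniq s_gens s_lin.
Qed.
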